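(* Let $p,n\ge 1$, let $x_1,\dots,x_k\in\mathbb{R}$ be distinct points and let $m_1,\dots,m_k\ge 1$ be integers (the multiplicities of the points) with $\sum_{i=1}^k m_i=np$. For each $i$ let $v_{i,1},\dots,v_{i,m_i}\in\mathbb{R}^p$ be non-zero, linearly independent column vectors. Put $$X=(v_{1,1}\ \cdots\ v_{1,m_1}\ \cdots\ v_{k,1}\ \cdots\ v_{k,m_k})\in\mathbb{R}^{p\times np},\qquad J=\mathrm{diag}(\underbrace{x_1,\dots,x_1}_{m_1},\dots,\underbrace{x_k,\dots,x_k}_{m_k})\in\mathbb{R}^{np\times np},$$ and assume that the $np\times np$ matrix $\mathrm{col}(XJ^l)_{l=0}^{n-1}$ is non-singular. Let $F$ be a $p\times p$ real matrix-valued function (defined at the points $x_i$). Then the interpolation matrix polynomial of the Lagrange interpolation problem, i.e. the matrix polynomial $P(x)=A_{n-1}x^{n-1}+\dots+A_1x+A_0$ with $A_j\in\mathbb{R}^{p\times p}$ satisfying $$P(x_i)\,v_{i,j}=F(x_i)\,v_{i,j},\qquad j=1,\dots,m_i,\quad i=1,\dots,k,$$ is given by $$P(x)=\sum_{i=1}^k F(x_i)\,W_i(x),\qquad W_i(x)=\frac{1}{x-x_i}\,(v_{i,1}\ \cdots\ v_{i,m_i})\begin{pmatrix} w_{i,1}^T\\ \vdots\\ w_{i,m_i}^T\end{pmatrix}\hat{Q}_n(x),$$ where $w_{i,j}^T$ is the $(m_1+\dots+m_{i-1}+j)$-th row of $V_n$, and $\hat{Q}_n(x)$ is the monic $p\times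 p$ matrix polynomial of degree $n$ with Jordan pair $(X,J)$.
   Context: For $X$ of size $p\times np$ and $J$ of size $np\times np$, $\mathrm{col}(XJ^l)_{l=0}^{n-1}$ denotes the $np\times np$ matrix obtained by stacking $X, XJ,\dots,XJ^{n-1}$ vertically. The $np\times p$ matrices $V_1,\dots,V_n$ are defined by $(V_1\ V_2\ \cdots\ V_n)=\left(\mathrm{col}(XJ^l)_{l=0}^{n-1}\right)^{-1}$. For a Jordan matrix $J$ and $X$ with $\mathrm{col}(XJ^l)_{l=0}^{n-1}$ non-singular, the monic matrix polynomial of degree $n$ with Jordan pair $(X,J)$ is the (unique) matrix polynomial $\hat{Q}_n(x)=Ix^n+B_{n-1}x^{n-1}+\dots+B_1x+B_0$, $B_j\in\mathbb{R}^{p\times p}$, satisfying $XJ^n+B_{n-1}XJ^{n-1}+\dots+B_1XJ+B_0X=0$. The expression for $W_i(x)$ is a matrix polynomial (the factor $x-x_i$ divides out), and its value at $x=x_i$ is understood accordingly. *)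

(* Defs.v *)
From mathcomp Require Import all_boot all_order all_algebra.
From mathcomp Require Import reals.

Set Implicit Arguments.
Unset Strict Implicit.
Unset Printing Implicit Defensive.

Import GRing.Theory.
Local Open Scope ring_scope.

(* Matrix polynomials are matrices with entries in {poly R}: this also makes
   sense for p = 0, unlike {poly 'M[R]_p}. *)

Definition mxpoly_of (R : nzRingType) (p n : nat) (A : 'I_n -> 'M[R]_p) :
    'M[{poly R}]_p :=
  \sum_(j < n) 'X^j *: map_mx polyC (A j).

Definition mxpoly_eval (R : nzRingType) (p : nat) (P : 'M[{poly R}]_p) (a : R) :
    'M[R]_p :=
  map_mx (fun q : {poly R} => q.[a]) P.

Lemma sum_ord_const (n p : nat) : (\sum_(l < n) p = n * p)%N.
Proof. by rewrite sum_nat_const card_ord. Qed.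

Definition last_ord (n : nat) (hn : (0 < n)%N) : 'I_n :=
  Ordinal (etrans (ltn_predL n) hn).

Section JordanPair.
Variables (R : fieldType) (p n : nat).
Variables (X : 'M[R]_(p, n * p)) (J : 'M[R]_(n * p)).

(* col(X J^l)_{l=0}^{n-1} *)
Definition colXJ : 'M[R]_(n * p) :=
  castmx (sum_ord_const n p, erefl (n * p)%N) (\mxcol_(l < n) (X *m J ^+ l)).

(* (V_1 ... V_n) = colXJ^-1, with indices starting from 0. *)
Definition invblock (l : 'I_n) : 'M[R]_(n * p, p) :=
  submxrow (castmx (erefl (n * p)%N, esym (sum_ord_const n p)) (invmx colXJ)) l.

Definition is_monic_jordan_mxpoly (Q : 'M[{poly R}]_p) : Prop :=
  exists B : 'I_n -> 'M[R]_p,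
    Q = 'X^n *: 1%:M + mxpoly_of B /\
    X *m J ^+ n + \sum_(l < n) B l *m X *m J ^+ l = 0.

End JordanPair.

Section Interpolation.
Variables (R : fieldType) (p n k : nat) (m : 'I_k -> nat).
Variable hm : (\sum_(i < k) m i = n * p)%N.
Variables (x : 'I_k -> R) (v : forall i : 'I_k, (m i).-tuple 'cV[R]_p).

(* (v_{i,1} ... v_{i,m_i}) *)
Definition vmx (i : 'I_k) : 'M[R]_(p, m i) :=
  \matrix_(a, j) tnth (v i) j a 0.

Definition interpX : 'M[R]_(p, n * p) :=
  castmx (erefl p, hm) (\mxrow_(i < k) vmx i).

Definition interpJ : 'M[R]_(n * p) :=
  castmx (hm, hm) (\mxdiag_(i < k) ((x i)%:M : 'M[R]_(m i))).

(* The rows w_{i,1}^T, ..., w_{i,m_i}^T of V_n; the value of tagnat.Rank i j is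
   (\sum_(i' < k | i' < i) m i') + j, see tagnat.RankEsum. *)
Definition wmx (hn : (0 < n)%N) (i : 'I_k) : 'M[R]_(m i, p) :=
  \matrix_(j < m i)
    row (cast_ord hm (tagnat.Rank i j))
        (invblock interpX interpJ (last_ord hn)).

(* (x - x_i) W_i(x) *)
Definition Wnum (hn : (0 < n)%N) (Q : 'M[{poly R}]_p) (i : 'I_k) :
    'M[{poly R}]_p :=
  map_mx polyC (vmx i *m wmx hn i) *m Q.

(* Entrywise Euclidean quotient; it is W_i(x) provided the division is exact. *)
Definition W (hn : (0 < n)%N) (Q : 'M[{poly R}]_p) (i : 'I_k) :
    'M[{poly R}]_p :=
  map_mx (fun q : {poly R} => q %/ ('X - (x i)%:P)) (Wnum hn Q i).

Definition is_interpolant (F : R -> 'M[R]_p) (P : 'M[{poly R}]_p) : Prop :=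
  (exists A : 'I_n -> 'M[R]_p, P = mxpoly_of A) /\
  forall (i : 'I_k) (j : 'I_(m i)),
    mxpoly_eval P (x i) *m tnth (v i) j = F (x i) *m tnth (v i) j.

End Interpolation.

(* Main.v *)
(* Let V_l be the blocks of the inverse of col(X J^l) and U(x) = sum_l V_l x^l.
   Reading off the two inverse identities gives X J^j U(x) = x^j I for j < n and
   Q(x) = x^n I - X J^n U(x), whence V_n Q(x) = (x I - J) U(x).  Since J is
   diagonal, W_i(x) is (v_{i,1} ... v_{i,m_i}) times the i-th group of rows of
   U(x), so that sum_i F(x_i) W_i(x) = Y U(x), where Y has the columns
   F(x_i) v_{i,j}.  On the other hand the interpolation conditions say that
   sum_l A_l X J^l = Y, i.e. A_l = Y V_l for all l. *)
Require Import Defs.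
From mathcomp Require Import all_boot all_order all_algebra.
From mathcomp Require Import reals.

Import GRing.Theory.
Local Open Scope ring_scope.

(** * Jordan pairs and the block columns of the inverse *)

Section JordanPairTheory.
Set Implicit Arguments.
Unset Strict Implicit.
Variables (R : fieldType) (p n : nat).
Variables (X : 'M[R]_(p, n * p)) (J : 'M[R]_(n * p)).
Hypothesis col_unit : colXJ X J \in unitmx.

Local Notation V := (invblock X J).
Local Notation "A ^:C" := (map_mx polyC A) (at level 2, format "A ^:C").

Lemma cast_colXJ :
  \mxcol_(l < n) (X *m J ^+ l)
  = castmx (esym (sum_ord_const n p), erefl (n * p)%N) (colXJ X J).
Proof. by rewrite castmx_comp castmx_id. Qed.

Lemma castmx_mulmx (S : pzSemiRingType) a b b' c (e : b = b') (A : 'M[S]_(a, b))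
    (B : 'M[S]_(b, c)) :
  castmx (erefl a, e) A *m castmx (e, erefl c) B = A *m B.
Proof. by case: b' / e. Qed.

Lemma sum_invblock_colXJ : \sum_(l < n) V l *m (X *m J ^+ l) = 1%:M.
Proof.
rewrite -mul_mxrow_mxcol submxrowK cast_colXJ castmx_mulmx.
exact: mulVmx.
Qed.

Lemma mulmx_XJ_invblock (l j : 'I_n) :
  X *m J ^+ l *m V j = if l == j then 1%:M else 0.
Proof.
have : \mxcol_(l < n) (X *m J ^+ l) *m \mxrow_j V j = 1%:M.
  rewrite submxrowK cast_colXJ.
  by case: _ / (esym (sum_ord_const n p)); rewrite mulmxV.
(* The identity is recast as a block diagonal matrix so that blocks can be compared; the
   [conform_mx] this brings in acts between equal sizes. *)
rewrite mul_mxcol_mxrow -mxdiagZ /mxdiag => /eq_mxblockP/(_ l j) ->.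
by rewrite conform_mx_id.
Qed.

(** The [A l] set side by side multiply the invertible [colXJ X J]. This serves twice: for the
    coefficients of the monic polynomial and for those of the interpolant. *)
Lemma colXJ_system q (A : 'I_n -> 'M[R]_(q, p)) (Y : 'M[R]_(q, n * p)) :
  \sum_(l < n) A l *m (X *m J ^+ l) = Y <-> forall l, A l = Y *m V l.
Proof.
split=> [<- l | eA].
  rewrite mulmx_suml (bigD1 l) //= -mulmxA mulmx_XJ_invblock eqxx mulmx1.
  rewrite big1 ?addr0 // => j /negPf jl.
  by rewrite -mulmxA mulmx_XJ_invblock jl mulmx0.
under eq_bigr do rewrite eA -mulmxA.
by rewrite -mulmx_sumr sum_invblock_colXJ mulmx1.
Qed.

Definition invblock_poly : 'M[{poly R}]_(n * p, p) :=
  \sum_(l < n) 'X^l *: (V l)^:C.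

Local Notation U := invblock_poly.

Lemma mulmx_invblock_poly q (Y : 'M[R]_(q, n * p)) :
  Y^:C *m U = \sum_(l < n) 'X^l *: (Y *m V l)^:C.
Proof.
by rewrite mulmx_sumr; apply: eq_bigr => l _; rewrite -scalemxAr map_mxM.
Qed.

Lemma mulmx_XJ_invblock_poly (l : 'I_n) :
  (X *m J ^+ l)^:C *m U = 'X^l *: 1%:M.
Proof.
rewrite mulmx_invblock_poly (bigD1 l) //= mulmx_XJ_invblock eqxx map_mx1.
rewrite big1 ?addr0 // => j jl.
by rewrite mulmx_XJ_invblock eq_sym (negPf jl) map_mx0 scaler0.
Qed.

(** The lower coefficients [- (X *m J ^+ n) *m V l] are those that [colXJ_system] forces for the
    right-hand side [- (X *m J ^+ n)]. *)
Definition monic_jordan_mxpoly : 'M[{poly R}]_p :=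
  'X^n *: 1%:M - (X *m J ^+ n)^:C *m U.

Local Notation Q := monic_jordan_mxpoly.

Lemma is_monic_jordan_mxpolyE Q' : is_monic_jordan_mxpoly X J Q' <-> Q' = Q.
Proof.
have eB (B : 'I_n -> 'M[R]_p) : X *m J ^+ n + \sum_(l < n) B l *m X *m J ^+ l = 0
    <-> forall l, B l = - (X *m J ^+ n) *m V l.
  rewrite -colXJ_system; under eq_bigr do rewrite -mulmxA.
  split=> [/eqP|->]; last by rewrite subrr.
  by rewrite addrC addr_eq0 => /eqP.
have eQ (B : 'I_n -> 'M[R]_p) : (forall l, B l = - (X *m J ^+ n) *m V l) ->
    'X^n *: 1%:M + mxpoly_of B = Q.
  move=> B_def; congr (_ + _).
  rewrite -mulNmx -map_mxN mulmx_invblock_poly.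
  by apply: eq_bigr => l _; rewrite B_def.
split=> [[B [-> /eB /eQ]] // | ->].
exists (fun l => - (X *m J ^+ n) *m V l); split; first exact/esym/eQ.
exact/eB.
Qed.

(** Inserting the left inverse identity before [J] splits [J U] into the terms [V l] times
    [X J^(l+1) U]. For [l + 1 < n] such a term is [x^(l+1) V l] and cancels against [x U]; the last
    index leaves [x^n I - X J^n U], which is [Q]. *)
Lemma invblock_last_mulmx (hn : (0 < n)%N) :
  (V (last_ord hn))^:C *m Q = char_poly_mx J *m U.
Proof.
rewrite /char_poly_mx mulmxBl mul_scalar_mx.
have -> : J^:C *m U = \sum_(l < n) (V l)^:C *m ((X *m J ^+ l.+1)^:C *m U).
  rewrite -{1}[J]mul1mx -sum_invblock_colXJ mulmx_suml.
  rewrite (raddf_sum (map_mx polyC)) mulmx_suml.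
  by apply: eq_bigr => l _ /=; rewrite exprSr !(mulmxA, map_mxM).
rewrite scaler_sumr !(bigD1 (last_ord hn) isT) /=.
rewrite opprD addrACA -sumrB big1 => [|l l_last]; last first.
  have ltl : (l.+1 < n)%N.
    rewrite ltn_neqAle ltn_ord andbT; apply: contraNneq l_last => e.
    by apply/eqP/val_inj/succn_inj; rewrite /= prednK.
  rewrite (mulmx_XJ_invblock_poly (Ordinal ltl)) -scalemxAr mulmx1 scalerA.
  by rewrite -exprS subrr.
by rewrite addr0 scalerA -exprS (ltn_predK hn) mulmxBr -scalemxAr mulmx1.
Qed.

End JordanPairTheory.

(** * Interpolation data grouped by node *)

Section InterpolationTheory.
Set Implicit Arguments.
Unset Strict Implicit.
Variables (R : fieldType) (p n k : nat) (m : 'I_k -> nat).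
Variable hm : (\sum_(i < k) m i = n * p)%N.
Variables (x : 'I_k -> R) (v : forall i : 'I_k, (m i).-tuple 'cV[R]_p).

Local Notation X := (interpX hm v).
Local Notation J := (interpJ hm x).
Local Notation V := (invblock X J).
Local Notation U := (invblock_poly X J).
Local Notation "A ^:C" := (map_mx polyC A) (at level 2, format "A ^:C").

(** The indexing is that of [wmx], so [wmx] is [blockrows] of the last block of the inverse. *)
Definition blockrows (S : Type) q (i : 'I_k) (A : 'M[S]_(n * p, q)) :=
  mxsub (fun j : 'I_(m i) => cast_ord hm (tagnat.Rank i j)) id A.

Lemma mulmx_cast_mxrow (S : pzSemiRingType) q r (B : forall i, 'M[S]_(q, m i))
    (A : 'M[S]_(n * p, r)) :
  castmx (erefl q, hm) (\mxrow_i B i) *m A = \sum_i B i *m blockrows i A.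
Proof.
rewrite -[A in LHS](castmxKV hm (erefl r)) castmx_mulmx.
rewrite -[castmx _ A]submxcolK mul_mxrow_mxcol.
apply: eq_bigr => i _; congr (_ *m _).
by apply/matrixP => a b; rewrite !mxE castmxE /= cast_ord_id esymK.
Qed.

Lemma col_cast_mxrow (S : Type) q (B : forall i, 'M[S]_(q, m i)) i j :
  col (cast_ord hm (tagnat.Rank i j)) (castmx (erefl q, hm) (\mxrow_i B i))
  = col j (B i).
Proof.
rewrite -[in RHS](mxrowK B i) /submxrow col_colsub.
by apply/matrixP => a b; rewrite !mxE castmxE /= cast_ordK cast_ord_id mxE.
Qed.

(** Every column index is the rank of a pair [(i, j)], recovered by [tagnat.sig2]. *)
Lemma eq_col_blocks (S : Type) q (A B : 'M[S]_(q, n * p)) :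
  (forall i j, col (cast_ord hm (tagnat.Rank i j)) A
             = col (cast_ord hm (tagnat.Rank i j)) B) -> A = B.
Proof.
move=> eAB; apply/matrixP => a c.
have /matrixP/(_ a 0) := eAB _ (tagnat.sig2 (cast_ord (esym hm) c)).
by rewrite !mxE tagnat.sig2K cast_ordKV.
Qed.

Definition interpd : 'rV[R]_(n * p) :=
  castmx (erefl 1%N, hm) (\mxrow_i const_mx (x i)).

Lemma interpJE : J = diag_mx interpd.
Proof.
rewrite /interpJ /interpd.
under eq_mxdiag do rewrite -diag_const_mx.
by rewrite -diag_mxrow; case: _ / hm.
Qed.

Lemma interpdE i j : interpd 0 (cast_ord hm (tagnat.Rank i j)) = x i.
Proof.
have /matrixP/(_ 0 0) := col_cast_mxrow (fun i => const_mx (x i) : 'rV_(m i)) j.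
by rewrite !mxE.
Qed.

(** A diagonal matrix scales rows, and the diagonal of [J] is constant on each group. This is the
    source of the factor that [W] divides out. *)
Lemma blockrows_char_poly_mx q i (A : 'M[{poly R}]_(n * p, q)) :
  blockrows i (char_poly_mx J *m A) = ('X - (x i)%:P) *: blockrows i A.
Proof.
have -> : char_poly_mx J = diag_mx (const_mx 'X - interpd^:C).
  by rewrite /char_poly_mx interpJE map_diag_mx raddfB /= diag_const_mx.
by apply/matrixP => a b; rewrite mxE mul_diag_mx !mxE interpdE.
Qed.

Lemma col_mulmx_interpJ q i j l (A : 'M[R]_(q, n * p)) :
  let c := cast_ord hm (tagnat.Rank i j) in
  col c (A *m J ^+ l) = x i ^+ l *: col c A.
Proof.
move=> c; elim: l => [|l IHl]; first by rewrite expr0 mulmx1 scale1r.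
rewrite !exprSr mulmxA -scalerA.
have -> (B : 'M_(q, n * p)) : col c (B *m J) = x i *: col c B.
  apply/matrixP => a b; rewrite interpJE mul_mx_diag !mxE interpdE.
  exact: mulrC.
by rewrite IHl scalerA scalerA mulrC.
Qed.

Lemma col_interpX i j :
  col (cast_ord hm (tagnat.Rank i j)) X = tnth (v i) j.
Proof.
by rewrite col_cast_mxrow; apply/matrixP => a b; rewrite !mxE ord1.
Qed.

Lemma mxpoly_eval_mxpoly_of (A : 'I_n -> 'M[R]_p) a :
  mxpoly_eval (mxpoly_of A) a = \sum_(l < n) a ^+ l *: A l.
Proof.
apply/matrixP => b c; rewrite mxE !summxE horner_sum.
by apply: eq_bigr => l _; rewrite !mxE !hornerE.
Qed.

(** Since [x_i^l v_{i,j}] is a column of [X J^l], the interpolation conditions are the columns of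
    the system in [colXJ_system]. *)
Lemma mxpoly_eval_interp (A : 'I_n -> 'M[R]_p) i j :
  mxpoly_eval (mxpoly_of A) (x i) *m tnth (v i) j
  = col (cast_ord hm (tagnat.Rank i j)) (\sum_(l < n) A l *m (X *m J ^+ l)).
Proof.
rewrite mxpoly_eval_mxpoly_of mulmx_suml raddf_sum /=.
apply: eq_bigr => l _.
rewrite mulmxA col_mulmx_interpJ colEsub -mulmx_colsub -colEsub.
by rewrite col_interpX -scalemxAl.
Qed.

(** * The quotients [W] and the interpolant *)

Hypothesis col_unit : colXJ X J \in unitmx.
Variable hn : (0 < n)%N.
Local Notation Q := (monic_jordan_mxpoly X J).

(** Row group [i] of [invblock_last_mulmx]: taking rows commutes with right multiplication by
    [Q]. *)
Lemma Wnum_monic i :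
  Wnum hm x v hn Q i = ('X - (x i)%:P) *: ((vmx v i)^:C *m blockrows i U).
Proof.
rewrite /Wnum.
have -> : wmx hm x v hn i = blockrows i (V (last_ord hn)).
  by apply/matrixP => a b; rewrite !mxE.
rewrite map_mxM -mulmxA scalemxAr; congr (_ *m _).
rewrite -blockrows_char_poly_mx -(invblock_last_mulmx col_unit hn).
by rewrite [RHS]/blockrows -mul_rowsub_mx map_mxsub.
Qed.

Lemma W_monic i : W hm x v hn Q i = (vmx v i)^:C *m blockrows i U.
Proof.
apply/matrixP => a b; rewrite mxE Wnum_monic mxE mulKp //.
by rewrite polyXsubC_eq0.
Qed.

(** By [W_monic] this is a block row times a block column, the blocks of the latter being the row
    groups of [U]. *)
Lemma sum_W_monic (F : R -> 'M[R]_p) :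
  \sum_(i < k) (F (x i))^:C *m W hm x v hn Q i
  = (castmx (erefl p, hm) (\mxrow_i (F (x i) *m vmx v i)))^:C *m U.
Proof.
rewrite map_castmx.
have -> : (\mxrow_i (F (x i) *m vmx v i))^:C
        = \mxrow_i (F (x i) *m vmx v i)^:C by apply/matrixP => a b; rewrite !mxE.
rewrite mulmx_cast_mxrow.
by apply: eq_bigr => i _; rewrite W_monic map_mxM mulmxA.
Qed.

Lemma is_interpolantE (F : R -> 'M[R]_p) P :
  is_interpolant n x v F P <->
  P = (castmx (erefl p, hm) (\mxrow_i (F (x i) *m vmx v i)))^:C *m U.
Proof.
set Y := castmx _ _.
have YE i j : F (x i) *m tnth (v i) j = col (cast_ord hm (tagnat.Rank i j)) Y.
  rewrite col_cast_mxrow colEsub -mulmx_colsub -colEsub; congr (_ *m _).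
  by apply/matrixP => a b; rewrite !mxE ord1.
rewrite mulmx_invblock_poly; split=> [[[A ->] PF] | ->].
  apply: eq_bigr => l _; congr (_ *: map_mx _ _).
  (* Generalizing over [l] turns the goal into the whole linear system, which is then checked column
     by column. *)
  move: l; apply/(colXJ_system col_unit); apply: eq_col_blocks => i j.
  by rewrite -mxpoly_eval_interp PF.
split=> [|i j]; first by exists (fun l => Y *m V l).
rewrite -/(mxpoly_of (fun l => Y *m V l)) mxpoly_eval_interp YE; congr col.
exact/(colXJ_system col_unit).
Qed.

End InterpolationTheory.

Theorem theorem4p3 (R : realType) (p n k : nat)
    (hp : (0 < p)%N) (hn : (0 < n)%N)
    (x : 'I_k -> R) (x_inj : injective x)
    (m : 'I_k -> nat) (m_gt0 : forall i : 'I_k, (0 < m i)%N)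
    (hm : (\sum_(i < k) m i = n * p)%N)
    (v : forall i : 'I_k, (m i).-tuple 'cV[R]_p)
    (v_neq0 : forall (i : 'I_k) (j : 'I_(m i)), tnth (v i) j != 0)
    (v_free : forall i : 'I_k, free (v i))
    (col_unit : colXJ (interpX hm v) (interpJ hm x) \in unitmx)
    (F : R -> 'M[R]_p) :
  exists Q : 'M[{poly R}]_p,
    unique (is_monic_jordan_mxpoly (interpX hm v) (interpJ hm x)) Q /\
    (forall i : 'I_k, ('X - (x i)%:P) *: W hm x v hn Q i = Wnum hm x v hn Q i) /\
    (forall P : 'M[{poly R}]_p,
       is_interpolant n x v F P <->
       P = \sum_(i < k) map_mx polyC (F (x i)) *m W hm x v hn Q i).
Proof.
exists (monic_jordan_mxpoly (interpX hm v) (interpJ hm x)); split; last split.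
- split; first exact/is_monic_jordan_mxpolyE.
  by move=> Q' /(is_monic_jordan_mxpolyE col_unit) ->.
(* The Euclidean quotient in [W] is exact. *)
- by move=> i; rewrite W_monic // Wnum_monic.
- by move=> P; rewrite sum_W_monic //; exact: is_interpolantE.
Qed.
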